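(* Let $z_1,\dots,z_n$ be distinct points in the open unit disk $\mathbb{D}$, and let $w_1,\dots,w_n$ be in $\mathbb{D}$. Then there exists an analytic function $f\in H^\infty_1$ with $\|f\|_\infty\le 1$ such that $f(z_i)=w_i$ for $i=1,\dots,n$ if and only if there exists $\lambda\in\mathbb{D}$ such that the $n\times n$ matrix \[ \left[\frac{z_i^2\,\overline{z_j^2}-\varphi_\lambda(w_i)\,\overline{\varphi_\lambda(w_j)}}{1-z_i\overline{z_j}}\right]_{i,j=1}^n \] is positive semidefinite.
   Context: $H^\infty(\mathbb{D})$ is the algebra of bounded analytic functions on $\mathbb{D}$ with $\|f\|_\infty=\sup_{z\in\mathbb{D}}|f(z)|$, and $H^\infty_1=\{f\in H^\infty(\mathbb{D}): f'(0)=0\}$. For $\lambda\in\mathbb{D}$, $\varphi_\lambda(z)=\dfrac{z-\lambda}{1-\overline{\lambda}z}$. *)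

(* Defs.v *)
From HB Require Import structures.
From mathcomp Require Import all_boot all_order all_algebra.
From mathcomp Require Import all_classical all_reals all_analysis.
From mathcomp Require Export complex.

Set Implicit Arguments.
Unset Strict Implicit.
Unset Printing Implicit Defensive.

Import Order.TTheory GRing.Theory Num.Theory.
Import numFieldNormedType.Exports.

Local Open Scope classical_set_scope.
Local Open Scope ring_scope.

Definition unit_disk (R : realType) : set R[i] := [set z | `|z| < 1].
Arguments unit_disk R : clear implicits.

Section BoundedAnalytic.
Variable R : realType.
Implicit Type f : R[i] -> R[i].

Definition analytic_at f (z0 : R[i]) : Prop :=
  exists a : nat -> R[i], exists2 r : R, 0 < r &
    forall z : R[i], `|z - z0| < r%:C%C ->
      (series (fun k => a k * (z - z0) ^+ k) : nat -> R[i]^o) @ \oo -->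
        (f z : R[i]^o).

Definition analytic_on (D : set R[i]) f : Prop :=
  forall z0, D z0 -> analytic_at f z0.

(* The library modulus is valued in [R[i]], with a zero imaginary part;
   [complex.Re] makes it an element of [R], where suprema exist. *)
Definition modulus (z : R[i]) : R := complex.Re `|z|.

(* Functions on the disk are represented by total functions, whose values
   outside the disk are irrelevant. *)
Definition Hinfty f : Prop :=
  analytic_on (unit_disk R) f /\
  exists M : R, forall z, unit_disk R z -> modulus (f z) <= M.

(* [sup] is the usual supremum only for sets that are bounded above, hence
   this is the norm only for [f] in [Hinfty]. *)
Definition Hinfty_norm f : R := sup [set modulus (f z) | z in unit_disk R].

Definition Hinfty1 f : Prop :=
  Hinfty f /\ derive1 (f : R[i]^o -> R[i]^o) 0 = 0.

Definition disk_aut (lambda z : R[i]) : R[i] :=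
  (z - lambda) / (1 - lambda^* * z).

(* [0 <= x] in [R[i]] says that [x] is real and nonnegative, so this forces
   [A] to be Hermitian. *)
Definition psdmx n (A : 'M[R[i]]_n) : Prop :=
  forall v : 'cV[R[i]]_n, 0 <= (map_mx Num.conj v^T *m A *m v) 0 0.

End BoundedAnalytic.

(* Main.v *)
(* If [f] is as in the theorem and [lambda = f 0], then [phi_lambda \o f] is a
   Schur function with a double zero at [0], so two applications of Schwarz's
   lemma give [phi_lambda (f z) = z^2 h(z)] with [h] again a Schur function; every
   [f] arises in this way from some [lambda] and [h].  The matrix is congruent,
   through the numbers [z_i^2], to the Pick matrix of the values of [h], and the
   theorem reduces to that of Nevanlinna and Pick.  (A node [z_i = 0] imposes no
   condition on [h]: there the diagonal entry forces [w_i = lambda].)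

   Nevanlinna-Pick is proved by Schur's algorithm: writing
   [phi_a \o f = phi_x * g] with [a = f(x)], the Pick matrix of [f] at [x] and
   further nodes is, up to congruence, a rank one positive matrix plus the Pick
   matrix of [g] at the further nodes.

   Cauchy's theory is not needed for the function theory used here: the local
   maximum principle is read off the first nonconstant Taylor coefficient, and
   spreads over the disk by compactness and connectedness. *)

Require Import Defs.
From mathcomp Require Import all_boot all_order all_algebra.
From mathcomp Require Import ring lra.
From mathcomp Require Import all_classical all_reals all_analysis.

Set Implicit Arguments.
Unset Strict Implicit.
Unset Printing Implicit Defensive.

Import Order.TTheory GRing.Theory Num.Theory.
Import numFieldNormedType.Exports.

Local Open Scope ring_scope.

(** * Power series as sequences of shifts *)

Section Modulus.
Variable R : realType.
Implicit Types x y z : R[i].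

Lemma normE z : `|z| = (modulus z)%:C%C.
Proof. by rewrite /modulus normc_def. Qed.

Lemma modulus_ge0 z : 0 <= modulus z.
Proof. by rewrite -ler0c -normE normr_ge0. Qed.

Lemma modulusM : {morph @modulus R : x y / x * y}.
Proof. by move=> x y; apply: complexI; rewrite rmorphM -!normE normrM. Qed.

Lemma modulusX n : {morph @modulus R : x / x ^+ n}.
Proof. by move=> x; apply: complexI; rewrite rmorphXn -!normE normrX. Qed.

Lemma modulusV : {morph @modulus R : x / x^-1}.
Proof. by move=> x; apply: complexI; rewrite fmorphV /= -!normE normfV. Qed.

Lemma modulus0 : modulus (0 : R[i]) = 0.
Proof. by apply: complexI; rewrite -normE normr0. Qed.

Lemma modulus1 : modulus (1 : R[i]) = 1.
Proof. by apply: complexI; rewrite -normE normr1. Qed.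

Lemma modulusN z : modulus (- z) = modulus z.
Proof. by apply: complexI; rewrite -!normE normrN. Qed.

Lemma modulusB x y : modulus (x - y) = modulus (y - x).
Proof. by rewrite -modulusN opprB. Qed.

Lemma modulusJ z : modulus z^* = modulus z.
Proof. by apply: complexI; rewrite -!normE norm_conjC. Qed.

Lemma modulus_eq0 z : (modulus z == 0) = (z == 0).
Proof. by rewrite -(inj_eq (@complexI R)) -normE normr_eq0. Qed.

Lemma modulus_gt0 z : (0 < modulus z) = (z != 0).
Proof. by rewrite lt_def modulus_eq0 modulus_ge0 andbT. Qed.

Lemma ler_modulusD x y : modulus (x + y) <= modulus x + modulus y.
Proof. by rewrite -lecR rmorphD /= -!normE ler_normD. Qed.

Lemma ler_modulusB x y : modulus x - modulus y <= modulus (x + y).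
Proof.
have := ler_modulusD (x + y) (- y); rewrite modulusN addrK; lra.
Qed.

Lemma modulus_split x y : modulus y <= modulus x + modulus (y - x).
Proof. by have := ler_modulusD x (y - x); rewrite addrC subrK. Qed.

Lemma ler_modulus_sum (I : Type) (s : seq I) (F : I -> R[i]) :
  modulus (\sum_(i <- s) F i) <= \sum_(i <- s) modulus (F i).
Proof.
elim: s => [|i s IH]; first by rewrite !big_nil modulus0.
by rewrite !big_cons (le_trans (ler_modulusD _ _)) // lerD2l.
Qed.

Lemma modulusR (t : R) : 0 <= t -> modulus t%:C%C = t.
Proof. by move=> t0; rewrite /modulus ger0_norm ?ler0c. Qed.

Lemma in_diskE z : unit_disk R z <-> modulus z < 1.
Proof. by rewrite /unit_disk/= normE -[X in _ < X](rmorph1 (real_complex R)) ltcR. Qed.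

Lemma modulus_sqr z : (modulus z ^+ 2)%:C%C = z * z^*.
Proof. by rewrite rmorphXn /= -normE normCK. Qed.

End Modulus.

Section Shifts.
Variable R : realType.
Local Notation C := R[i].
Implicit Types (f g : C -> C) (z h : C).

(* [F n h] is the [n]-th Taylor remainder of [f] at [z0] divided by [h ^+ n],
   so that the [n]-th Taylor coefficient is [F n 0]. *)
Definition shifts f (z0 : C) (r M s : R) (F : nat -> C -> C) : Prop :=
  [/\ 0 < r, 0 < M, 0 < s,
      forall h, modulus h < r -> F 0 h = f (z0 + h) &
      forall n h, modulus h < r ->
        modulus (F n h) <= M * s ^+ n /\ F n h = F n 0 + h * F n.+1 h].

(** Geometric bounds on all the shifts take the place of convergence, so that sums, products and
    inverses come down to finite identities and estimates. [analytic_atE] relates this notion to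
    power series. *)
Definition ana f z0 := exists r M s F, shifts f z0 r M s F.

Lemma shifts_near f z0 r M s F r' :
  0 < r' <= r -> shifts f z0 r M s F -> shifts f z0 r' M s F.
Proof.
case/andP=> r'0 r'r [r0 M0 s0 F0 FS]; split=> // [h hr|n h hr].
  by apply: F0; lra.
by apply: FS; lra.
Qed.

Lemma shifts_le f z0 r M s F M' s' :
  M <= M' -> s <= s' -> shifts f z0 r M s F -> shifts f z0 r M' s' F.
Proof.
move=> MM ss [r0 M0 s0 F0 FS]; split=> //; [lra|lra|move=> n h hr].
have [FM FE] := FS n h hr; split=> //; apply: le_trans FM _.
by apply: ler_pM; rewrite ?exprn_ge0 ?lerXn2r ?nnegrE; lra.
Qed.

Lemma ana_near f g z0 (r : R) : 0 < r ->
  (forall z, modulus (z - z0) < r -> f z = g z) -> ana f z0 -> ana g z0.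
Proof.
move=> r0 fg [r1 [M [s [F FF]]]]; have r10 : 0 < r1 by case: FF.
have [ra rb rc] : [/\ 0 < Num.min r r1, Num.min r r1 <= r & Num.min r r1 <= r1].
  by rewrite lt_min r0 r10 ge_min lexx ge_min lexx orbT.
have [_ M0 s0 F0 FS] := shifts_near (introT andP (conj ra rc)) FF.
exists (Num.min r r1), M, s, F; split=> // h hr.
by rewrite F0// fg// addrC addKr; apply: lt_le_trans hr _.
Qed.

Lemma ana_cst (c z0 : C) : ana (fun=> c) z0.
Proof.
exists 1, (1 + modulus c), 1, (fun n _ => if n is 0 then c else 0).
have c0 := modulus_ge0 c.
split=> //; first lra.
by move=> [|n] h _; rewrite ?expr1n ?modulus0; (split; [lra|ring]).
Qed.

Lemma ana_id (z0 : C) : ana id z0.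
Proof.
exists 1, (2 + modulus z0), 1,
  (fun n h => if n is n'.+1 then (if n' is 0 then 1 else 0) else z0 + h).
have c0 := modulus_ge0 z0.
split=> //; first lra.
move=> [|[|n]] h hr; rewrite ?expr1n ?modulus0 ?modulus1;
  (split; [|ring]); try lra.
by have := ler_modulusD z0 h; lra.
Qed.

Lemma ana2 f g z0 : ana f z0 -> ana g z0 -> exists r M s F G,
  shifts f z0 r M s F /\ shifts g z0 r M s G.
Proof.
move=> [r [M [s [F FF]]]] [r' [M' [s' [G GG]]]].
have [r0 M0 s0 _ _] := FF; have [r'0 M'0 s'0 _ _] := GG.
exists (Num.min r r'), (M + M'), (s + s'), F, G; split.
  apply: (@shifts_le _ _ _ M s); [lra|lra|].
  by apply: shifts_near FF; rewrite lt_min r0 r'0 ge_min lexx.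
apply: (@shifts_le _ _ _ M' s'); [lra|lra|].
by apply: shifts_near GG; rewrite lt_min r0 r'0 ge_min lexx orbT.
Qed.

Lemma anaD f g z0 : ana f z0 -> ana g z0 -> ana (fun z => f z + g z) z0.
Proof.
move=> /ana2 H /H [r [M [s [F [G [[r0 M0 s0 F0 FS] [_ _ _ G0 GS]]]]]]].
exists r, (2 * M), s, (fun n h => F n h + G n h); split=> // [|h hr|n h hr].
- lra.
- by rewrite F0 ?G0.
have [FM FE] := FS n h hr; have [GM GE] := GS n h hr; split.
  by have := ler_modulusD (F n h) (G n h); lra.
by rewrite FE GE; ring.
Qed.

(* The Cauchy product at the level of shifts: [sum_(k <= n) F_k(0) G_(n-k)(h)]
   with [F_n(h)] in place of [F_n(0)]. *)
Definition shift_mul (F G : nat -> C -> C) n h :=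
  F n h * G 0%N h + \sum_(k < n) F k 0 * G (n - k)%N h.

Lemma shift_mulE (F G : nat -> C -> C) n h :
  F n h = F n 0 + h * F n.+1 h ->
  (forall j, (j <= n)%N -> G j h = G j 0 + h * G j.+1 h) ->
  shift_mul F G n h = shift_mul F G n 0 + h * shift_mul F G n.+1 h.
Proof.
move=> FE GE; rewrite /shift_mul big_ord_recr /= subSnn FE.
have -> : \sum_(k < n) F k 0 * G (n - k)%N h =
  \sum_(k < n) F k 0 * G (n - k)%N 0 + h * \sum_(k < n) F k 0 * G (n.+1 - k)%N h.
  rewrite mulr_sumr -big_split /=; apply: eq_bigr => k _.
  by rewrite GE ?leq_subr// subSn ?mulrDr; [ring|exact/ltnW/ltn_ord].
by rewrite GE//; ring.
Qed.

Lemma anaM f g z0 : ana f z0 -> ana g z0 -> ana (fun z => f z * g z) z0.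
Proof.
move=> /ana2 H /H [r [M [s [F [G [[r0 M0 s0 F0 FS] [_ _ _ G0 GS]]]]]]].
(* Each of the [n.+1] terms of the product shift is at most [M ^+ 2 * s ^+ n]; the factor
   [n.+1 <= 2 ^ n] is absorbed by doubling [s]. *)
exists r, (M ^+ 2), (2 * s),
  (fun n h => F n h * G 0 h + \sum_(k < n) F k 0 * G (n - k)%N h).
split=> // [||h hr|n h hr].
- by rewrite exprn_gt0.
- lra.
- by rewrite big_ord0 addr0 F0 ?G0.
have m0 : modulus (0 : C) < r by rewrite modulus0.
split.
  apply: (@le_trans _ _ (\sum_(k < n.+1) M ^+ 2 * s ^+ n)).
    rewrite big_ord_recr /= addrC; apply: le_trans (ler_modulusD _ _) _.
    apply: lerD.
      rewrite modulusM; have [FM _] := FS n h hr; have [GM _] := GS 0 h hr.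
      have := ler_pM (modulus_ge0 _) (modulus_ge0 _) FM GM.
      by rewrite expr0 mulr1 expr2; lra.
    apply: le_trans (ler_modulus_sum _ _) _; apply: ler_sum => k _.
    have [FM _] := FS k 0 m0; have [GM _] := GS (n - k)%N h hr.
    have := ler_pM (modulus_ge0 _) (modulus_ge0 _) FM GM.
    rewrite modulusM mulrACA -exprD subnKC ?expr2//.
    exact/ltnW/ltn_ord.
  rewrite sumr_const card_ord exprMn -[_ *+ n.+1]mulr_natr.
  have -> : M ^+ 2 * (2 ^+ n * s ^+ n) = M ^+ 2 * s ^+ n * 2 ^+ n by ring.
  apply: ler_wpM2l; first by rewrite mulr_ge0 ?exprn_ge0 ?ltW.
  by rewrite -natrX ler_nat ltn_expl.
by apply: shift_mulE => [|j _]; [case: (FS n h hr)|case: (GS j h hr)].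
Qed.

Lemma ana_cont f z0 : ana f z0 -> exists r K : R,
  [/\ 0 < r, 0 < K & forall z, modulus (z - z0) < r ->
    modulus (f z - f z0) <= K * modulus (z - z0)].
Proof.
move=> [r [M [s [F [r0 M0 s0 F0 FS]]]]]; exists r, (M * s); split=> // [|z zr].
  exact: mulr_gt0.
have m0 : modulus (0 : C) < r by rewrite modulus0.
have -> : f z - f z0 = (z - z0) * F 1%N (z - z0).
  have := F0 _ zr; rewrite [z0 + _]addrC subrK => <-; have := F0 _ m0; rewrite addr0 => <-.
  by have [_ ->] := FS 0%N _ zr; rewrite addrC addKr.
rewrite modulusM mulrC; apply: ler_wpM2r; first exact: modulus_ge0.
by have [] := FS 1%N _ zr.
Qed.

(** Since [step n] reads only earlier values, the value at [n] is final once [step] has been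
    iterated more than [n] times. *)
Lemma course_of_values (T : Type) (t0 : T) (step : nat -> (nat -> T) -> T) :
  (forall n u v, (forall k, (k < n)%N -> u k = v k) -> step n u = step n v) ->
  exists u, forall n, u n = step n u.
Proof.
move=> step_ext; pose U m := iter m (fun u n => step n u) (fun=> t0).
have stable n m m' : (n < m)%N -> (n < m')%N -> U m n = U m' n.
  elim/ltn_ind: n m m' => n IH [|m] [|m']// nm nm'; apply: step_ext => k kn.
  by apply: IH => //; apply: leq_trans kn _.
exists (fun n => U n.+1 n) => n; apply: step_ext => k kn.
exact: stable.
Qed.

(** With [a = f z0] and [g = 1 / f], one has [g = 1 / a + h * (H * g)], where [H] is
    [- (f - a) / (a * h)]. Hence [G n.+1] is the [n]-th shift of the product [H * g], which involves
    only [G 0], ..., [G n]. *)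
Lemma anaV f z0 : f z0 != 0 -> ana f z0 -> ana (fun z => (f z)^-1) z0.
Proof.
move=> a0 fa; have [r1 [K1 [r10 K10 fK]]] := ana_cont fa.
have [r [M [s [F FF]]]] := fa.
set a := f z0 in a0; have a'0 : 0 < modulus a by rewrite modulus_gt0.
(* The last bound keeps [|f - a|] at most [|a| / 2], hence [|f|] at least [|a| / 2]. *)
pose r' := Num.min (Num.min r r1) (modulus a / (2 * K1)).
have [r0 M0 s0 _ _] := FF.
have r'0 : 0 < r' by rewrite !lt_min r0 r10 divr_gt0// mulr_gt0.
have [_ _ _ F0 FS] : shifts f z0 r' M s F.
  by apply: shifts_near FF; rewrite r'0 !ge_min lexx.
have fb h : modulus h < r' -> modulus a / 2 <= modulus (f (z0 + h)).
  rewrite !lt_min => /andP[/andP[_ h1] h2].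
  have := fK (z0 + h); rewrite [z0 + h]addrC addrK => /(_ h1) h3.
  have := ler_modulusB a (f (h + z0) - a).
  rewrite addrCA subrr addr0 => h4.
  have : K1 * modulus h <= modulus a / 2.
    move: h2; rewrite ltr_pdivlMr ?mulr_gt0//; lra.
  by rewrite -/a in h3; lra.
have fn0 h : modulus h < r' -> f (z0 + h) != 0.
  by move=> /fb h1; rewrite -modulus_gt0; apply: lt_le_trans h1; rewrite divr_gt0.
pose g0 h := (f (z0 + h))^-1.
pose H n h := - a^-1 * F n.+1 h.
pose step n (u : nat -> C -> C) h :=
  if n is m.+1 then H m h * g0 h + \sum_(k < m) H k 0 * u (m - k)%N h else g0 h.
have [|G GE] := @course_of_values _ (fun=> 0) step.
  move=> [|n] u v uv; rewrite /step//; apply/funext => h; congr (_ + _).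
  by apply: eq_bigr => k _; rewrite uv// ltnS leq_subr.
have G0 : G 0%N = g0 by rewrite GE.
have GS n : G n.+1 = shift_mul H G n by rewrite GE /shift_mul G0.
pose K := modulus a^-1 * M * s; pose B := 2 / modulus a.
have K0 : 0 < K by rewrite /K !mulr_gt0// modulusV invr_gt0.
have B0 : 0 < B by rewrite divr_gt0.
have HS n h : modulus h < r' -> H n h = H n 0 + h * H n.+1 h.
  by move=> hr; rewrite /H; have [_ ->] := FS n.+1 h hr; ring.
have Hb n h : modulus h < r' -> modulus (H n h) <= K * s ^+ n.
  move=> hr; rewrite /H modulusM modulusN /K -!mulrA -exprS.
  by apply: ler_wpM2l; [exact: modulus_ge0|have [] := FS n.+1 h hr].
exists r', B, (s + K), G; split=> //; first lra.
  by move=> h hr; rewrite G0.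
move=> n h hr; have m0 : modulus (0 : C) < r' by rewrite modulus0.
split.
  elim/ltn_ind: n => -[_|n IH].
    rewrite G0 expr0 mulr1 /g0 modulusV /B -[2 / _]invf_div lef_pV2 ?fb//.
      by rewrite posrE modulus_gt0 fn0.
    by rewrite posrE divr_gt0.
  rewrite GS /shift_mul.
  apply: (@le_trans _ _ (\sum_(k < n.+1) B * K * ((s + K) ^+ (n - k) * s ^+ k))).
    rewrite big_ord_recr /= subnn expr0 mul1r addrC.
    apply: le_trans (ler_modulusD _ _) _; apply: lerD.
      have := IH 0%N isT; rewrite expr0 mulr1 => GB.
      have := ler_pM (modulus_ge0 _) (modulus_ge0 _) (Hb n h hr) GB.
      by rewrite -modulusM => /le_trans; apply; lra.
    apply: le_trans (ler_modulus_sum _ _) _; apply: ler_sum => k _.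
    have GB := IH (n - k)%N (leq_subr _ _).
    have := ler_pM (modulus_ge0 _) (modulus_ge0 _) (Hb k 0 m0) GB.
    by rewrite -modulusM => /le_trans; apply; lra.
  (* The sum telescopes to [B * ((s + K) ^+ n.+1 - s ^+ n.+1)], [K] being the difference of the two
     bases; this dictates the rate [s + K]. *)
  rewrite -mulr_sumr -mulrA; apply: ler_wpM2l; first exact: ltW.
  have := subrXX (s + K) s n.+1; rewrite [s + K]addrC addrK /= => <-.
  by rewrite gerBl exprn_ge0// ltW.
elim/ltn_ind: n => -[_|n IH]; last first.
  by rewrite !GS; apply: shift_mulE => [|j jn]; [exact: HS|exact: IH].
rewrite GS /shift_mul big_ord0 addr0 G0 /g0 /H addr0 -/a.
have := F0 _ m0; rewrite addr0 -/a => Fa.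
have fE : f (z0 + h) = a + h * F 1%N h.
  by rewrite -F0//; have [_ ->] := FS 0%N h hr; rewrite Fa.
have := fn0 h hr; rewrite fE => f0.
by field; rewrite a0 f0.
Qed.

End Shifts.

(** * Division by a zero and the local maximum principle *)

Section LocalTheory.
Variable R : realType.
Local Notation C := R[i].
Implicit Types (f g : C -> C) (z h : C).

(** At [z0] the shifts of the quotient are those of [f], moved by one index; elsewhere it is a
    quotient of analytic functions with nonzero denominator. *)
Lemma ana_div f z0 : (forall z, unit_disk R z -> ana f z) -> unit_disk R z0 ->
  exists k, (forall z, unit_disk R z -> ana k z) /\
    forall z, f z = f z0 + (z - z0) * k z.
Proof.
move=> fa z0D; have [r [M [s [F [r0 M0 s0 F0 FS]]]]] := fa _ z0D.
pose k z := if z == z0 then F 1%N 0 else (f z - f z0) / (z - z0).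
have kE z : f z = f z0 + (z - z0) * k z.
  rewrite /k; case: eqVneq => [->|zz0]; first by ring.
  by field; rewrite subr_eq0.
exists k; split=> // z zD.
have [->|zz0] := eqVneq z z0.
  exists r, (M * s), s, (fun n => F n.+1); split=> //.
  - exact: mulr_gt0.
  - move=> h hr; have m0 : modulus (0 : C) < r by rewrite modulus0.
    rewrite /k -subr_eq0 addrC addKr; case: eqVneq => [->//|h0].
    have [_ E] := FS 0%N h hr; move: E (F0 _ m0) (F0 _ hr); rewrite addr0.
    by move=> -> -> <-; field.
  - by move=> n h hr; rewrite -mulrA -exprS; exact: FS.
have zz : 0 < modulus (z - z0) by rewrite modulus_gt0 subr_eq0.
apply: (@ana_near _ (fun y => (f y + - f z0) * (y + - z0)^-1) _ _ _ zz).
  move=> y yz; rewrite /k; case: eqVneq yz => // ->.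
  by rewrite modulusB ltxx.
apply: anaM; first by apply: anaD; [exact: fa|exact: ana_cst].
apply: anaV; first by rewrite subr_eq0.
by apply: anaD; [exact: ana_id|exact: ana_cst].
Qed.

Lemma le0_geometric (x c : R) : (forall n, x * 2 ^+ n <= c) -> x <= 0.
Proof.
move=> H; rewrite leNgt; apply/negP => x0.
have c0 : 0 <= c by have := H 0%N; lra.
have := archi_boundP (divr_ge0 c0 (ltW x0)).
set n := Num.bound _; rewrite ltr_pdivrMr// => cn.
have /(ler_wpM2l (ltW x0)) : (n%:R : R) <= 2 ^+ n by rewrite -natrX ler_nat ltnW// ltn_expl.
have := H n; lra.
Qed.

(* If the first nonconstant coefficient [a] of [f] at [z0] has index [m], then
   [|f|] increases in the direction of a root of [h ^+ m = f z0 / a]. *)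
Lemma local_max f z0 (r : R) : ana f z0 -> 0 < r ->
  (forall z, modulus (z - z0) < r -> modulus (f z) <= modulus (f z0)) ->
  exists2 r' : R, 0 < r' & forall z, modulus (z - z0) < r' -> f z = f z0.
Proof.
move=> [r1 [M [s [F FF]]]] r0 fmax; have [r10 M0 s0 F0 FS] := FF.
have m0 : modulus (0 : C) < r1 by rewrite modulus0.
have Ff0 : F 0%N 0 = f z0 by rewrite F0 ?addr0.
have FX n h : modulus h < r1 -> (forall m, (m < n)%N -> F m.+1 0 = 0) ->
    f (z0 + h) = f z0 + h ^+ n.+1 * F n.+1 h.
  move=> hr; elim: n => [|n IH] Fz.
    by rewrite -F0// -Ff0 expr1; have [] := FS 0%N h hr.
  rewrite IH => [|m mn]; last by apply: Fz; rewrite ltnS ltnW.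
  by have [_ ->] := FS n.+1 h hr; rewrite Fz// add0r mulrA -exprSr.
have [Fz|] := pselect (forall n, F n.+1 0 = 0).
  (* All coefficients after the constant one vanish, and [s * |z - z0| <= 1/2] here, so [FX] gives
     [|f z - f z0| <= M / 2 ^ n] for every [n]. *)
  exists (Num.min r1 (2 * s)^-1); first by rewrite lt_min r10 invr_gt0 mulr_gt0.
  move=> z; rewrite lt_min => /andP[zr zs].
  have [->//|zz0] := eqVneq z z0.
  apply/eqP; rewrite -subr_eq0 -modulus_eq0 eq_le modulus_ge0 andbT.
  apply: (@le0_geometric _ M) => n.
  have hE : modulus (f z - f z0) <= M * (s * modulus (z - z0)) ^+ n.+1.
    have := FX n _ zr (fun k _ => Fz k); rewrite [z0 + _]addrC subrK => ->.
    rewrite [f z0 + _]addrC addrK modulusM modulusX exprMn.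
    have [FM _] := FS n.+1 _ zr.
    have := ler_wpM2l (exprn_ge0 n.+1 (modulus_ge0 (z - z0))) FM; lra.
  have sh : s * modulus (z - z0) * 2 <= 1.
    by move: zs; rewrite -[X in _ < X]div1r ltr_pdivlMr ?mulr_gt0//; lra.
  have sh0 : 0 <= s * modulus (z - z0) * 2.
    by rewrite !mulr_ge0 ?modulus_ge0// ltW.
  have := exprn_ile1 n.+1 sh0 sh; rewrite exprMn => s1.
  have := ler_wpM2r (exprn_ge0 n.+1 (ler0n R 2)) hE.
  rewrite -mulrA => /le_trans/(_ (ler_wpM2l (ltW M0) s1)); rewrite mulr1.
  apply: le_trans; apply: ler_wpM2l; first exact: modulus_ge0.
  by rewrite exprS ler_peMl ?exprn_ge0// ler1n.
move=> /existsNP[n0 /eqP Fn0].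
case: (ex_minnP (ex_intro (fun n => F n.+1 0 != 0) n0 Fn0)) => m Fm mmin.
(* Adding a positive multiple of [u] to [f z0] increases the modulus: [u] is [f z0] itself, or [1]
   when [f z0 = 0]. *)
set a := F m.+1 0 in Fm; pose u := if f z0 == 0 then 1 else f z0.
have u0 : u != 0 by rewrite /u; case: ifP => [_|->]; rewrite ?oner_eq0.
pose zeta := m.+1.-root (u / a).
have zX : zeta ^+ m.+1 = u / a by rewrite rootCK.
pose B := modulus zeta ^+ m.+2 * (M * s ^+ m.+2).
have B0 : 0 <= B.
  apply: mulr_ge0; first by rewrite exprn_ge0 ?modulus_ge0.
  by rewrite mulr_ge0 ?exprn_ge0 ?ltW.
have zeta_ge0 := modulus_ge0 zeta.
have mu0 : 0 < modulus u by rewrite modulus_gt0.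
(* The first bound keeps [h = t * zeta] in both disks; the second makes the remainder, at most
   [t ^+ m.+1 * (t * B)], smaller than the gain [t ^+ m.+1 * |u|]. *)
pose t := Num.min (Num.min r r1 / (1 + modulus zeta)) (modulus u / (1 + B)).
have rr0 : 0 < Num.min r r1 by rewrite lt_min r0.
have t0 : 0 < t by rewrite lt_min !divr_gt0//; lra.
have tz : t * modulus zeta < Num.min r r1.
  have : t <= Num.min r r1 / (1 + modulus zeta) by rewrite ge_min lexx.
  by rewrite ler_pdivlMr; lra.
have tB : t * B < modulus u.
  have : t <= modulus u / (1 + B) by rewrite ge_min lexx orbT.
  by rewrite ler_pdivlMr; lra.
pose h := t%:C%C * zeta.
have hm : modulus h = t * modulus zeta by rewrite modulusM modulusR ?ltW.
have [hr hr1] : modulus h < r /\ modulus h < r1.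
  by move: tz; rewrite -hm lt_min => /andP.
have := fmax (z0 + h); rewrite [z0 + h]addrC addrK => /(_ hr).
rewrite leNgt => /negP; case.
rewrite addrC (FX m)// => [|k km]; last first.
  by apply/eqP/negPn/negP => /mmin; rewrite leqNgt km.
have [_ ->] := FS m.+1 h hr1; rewrite -/a.
have -> : f z0 + h ^+ m.+1 * (a + h * F m.+2 h) =
    (f z0 + (t ^+ m.+1)%:C%C * u) + h ^+ m.+2 * F m.+2 h.
  rewrite mulrDr mulrA -exprSr {1}/h exprMn zX rmorphXn /= -addrA.
  by congr (_ + (_ + _)); field.
have e1 : modulus (f z0 + (t ^+ m.+1)%:C%C * u) = modulus (f z0) + t ^+ m.+1 * modulus u.
  have tm : 0 <= t ^+ m.+1 by rewrite exprn_ge0 ?ltW.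
  rewrite /u; case: eqVneq => [->|f0].
    by rewrite mulr1 add0r modulusR// modulus0 modulus1; ring.
  have -> : f z0 + (t ^+ m.+1)%:C%C * f z0 = (1 + t ^+ m.+1)%:C%C * f z0.
    by rewrite rmorphD rmorph1; ring.
  by rewrite modulusM modulusR; [ring|lra].
have e2 : modulus (h ^+ m.+2 * F m.+2 h) <= t ^+ m.+1 * (t * B).
  have [FM _] := FS m.+2 h hr1.
  rewrite modulusM modulusX hm exprMn [t ^+ m.+2]exprSr /B.
  have := ler_wpM2l (exprn_ge0 m.+2 zeta_ge0) FM.
  move=> /(ler_wpM2l (exprn_ge0 m.+2 (ltW t0))); rewrite exprSr; lra.
have := ler_modulusB (f z0 + (t ^+ m.+1)%:C%C * u) (h ^+ m.+2 * F m.+2 h).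
rewrite e1; have : t ^+ m.+1 * (t * B) < t ^+ m.+1 * modulus u.
  by rewrite ltr_pM2l// exprn_gt0.
lra.
Qed.

End LocalTheory.

(** * Shifts, convergent power series and derivatives *)

Section Analytic.
Variable R : realType.
Local Notation C := R[i].
Implicit Types (f g : C -> C) (z h : C).

Lemma shiftsX f z0 r M s F n h : shifts f z0 r M s F -> modulus h < r ->
  f (z0 + h) = \sum_(k < n) F k 0 * h ^+ k + h ^+ n * F n h.
Proof.
move=> [r0 M0 s0 F0 FS] hr; elim: n => [|n ->].
  by rewrite big_ord0 F0//; ring.
by rewrite big_ord_recr /=; have [_ ->] := FS n h hr; rewrite exprSr; ring.
Qed.

Lemma cvg_modulusP (u : nat -> C) (l : C) :
  ((u : nat -> C^o) @ \oo --> (l : C^o))%classic <->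
  (forall e : R, 0 < e -> exists N, forall n, (N <= n)%N -> modulus (l - u n) < e).
Proof.
split=> [ul e e0|H].
  have /cvgrPdist_lt/(_ e%:C%C) := ul.
  rewrite ltcR => /(_ e0) [N _ HN]; exists N => n Nn.
  by have := HN n Nn; rewrite /= normE ltcR.
apply/cvgrPdist_lt => e e0.
have eE : e = (complex.Re e)%:C%C by rewrite RRe_real// gtr0_real.
have := H (complex.Re e); rewrite -ltcR -eE => /(_ e0)[N HN].
by exists N => // n /= /HN; rewrite normE eE ltcR.
Qed.

(** From shifts to series, the remainder [h ^+ n * F n h] is at most [M * (s * |h|) ^+ n].
    Conversely, the terms of the series are bounded at the radius [rho], and comparison with a
    geometric series bounds the remainders divided by [h ^+ n]. *)
Lemma analytic_atE f z0 : analytic_at f z0 <-> ana f z0.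
Proof.
split=> [[a [r r0 fa]]|[r [M [s [F FF]]]]]; last first.
  have [r0 M0 s0 F0 FS] := FF.
  exists (fun k => F k 0), (Num.min r (2 * s)^-1).
    by rewrite lt_min r0 invr_gt0 mulr_gt0.
  move=> z; rewrite normE ltcR lt_min => /andP[zr zs].
  apply/cvg_modulusP => e e0.
  have := archi_boundP (divr_ge0 (ltW M0) (ltW e0)); set N := Num.bound _ => eN.
  exists N => n Nn; rewrite /series /= big_mkord.
  have := shiftsX n FF zr; rewrite [z0 + _]addrC subrK => ->.
  rewrite [X in X - _]addrC addrK modulusM modulusX.
  have sh : 2 * (modulus (z - z0) * s) <= 1.
    by move: zs; rewrite -[X in _ < X]div1r ltr_pdivlMr ?mulr_gt0//; lra.
  have sh0 : 0 <= modulus (z - z0) * s by rewrite mulr_ge0 ?modulus_ge0 ?ltW.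
  have := exprn_ile1 n (mulr_ge0 (ler0n R 2) sh0) sh; rewrite exprMn => s1.
  have [FM _] := FS n _ zr.
  have := ler_wpM2l (exprn_ge0 n (modulus_ge0 (z - z0))) FM.
  rewrite mulrCA -exprMn => /le_lt_trans; apply.
  have n2 : M < 2 ^+ n * e.
    move: eN; rewrite ltr_pdivrMr// => /lt_le_trans; apply.
    rewrite ler_pM2r// -natrX ler_nat; apply: leq_trans Nn _.
    by rewrite ltnW// ltn_expl.
  have p2 : 0 < (2 : R) ^+ n by rewrite exprn_gt0.
  rewrite -(ltr_pM2l p2); apply: le_lt_trans n2.
  by rewrite mulrCA; apply: le_trans (ler_wpM2l (ltW M0) s1) _; rewrite mulr1.
have fE h : modulus h < r -> forall e : R, 0 < e -> exists N, forall n, (N <= n)%N ->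
    modulus (f (z0 + h) - \sum_(k < n) a k * h ^+ k) < e.
  move=> hr e e0; have := fa (z0 + h); rewrite [z0 + h]addrC addrK normE ltcR => /(_ hr).
  move=> /cvg_modulusP/(_ e e0)[N HN]; exists N => n /HN.
  by rewrite /series /= big_mkord.
pose rho := r / 2; have rho0 : 0 < rho by rewrite divr_gt0.
have rhor : rho < r by rewrite /rho; lra.
(* From the index [N] on, a term is the difference of two consecutive errors smaller than [1]; the
   earlier terms are covered by their sum. *)
have [M M0 aM] : exists2 M, 0 < M & forall k, modulus (a k) * rho ^+ k <= M.
  have [|N HN] := fE rho%:C%C _ 1 ltr01; first by rewrite modulusR ?ltW.
  exists (2 + \sum_(k < N) modulus (a k) * rho ^+ k).
    apply: ltr_wpDr => //; apply: sumr_ge0 => k _.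
    by rewrite mulr_ge0 ?modulus_ge0 ?exprn_ge0 ?ltW.
  move=> k; have S0 : 0 <= \sum_(k < N) modulus (a k) * rho ^+ k.
    by apply: sumr_ge0 => j _; rewrite mulr_ge0 ?modulus_ge0 ?exprn_ge0 ?ltW.
  have [Nk|kN] := leqP N k.
    apply: (@le_trans _ _ 2); last lra.
    have := HN k Nk; have := HN k.+1 (leqW Nk); rewrite big_ord_recr /=.
    set S := \sum_(i < k) _; set y := f _ => h1 h2.
    have -> : modulus (a k) * rho ^+ k = modulus (a k * rho%:C%C ^+ k).
      by rewrite modulusM modulusX modulusR ?ltW.
    have -> : a k * rho%:C%C ^+ k = (y - S) - (y - (S + a k * rho%:C%C ^+ k)) by ring.
    by apply: le_trans (ler_modulusD _ _) _; rewrite modulusN; lra.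
  rewrite (bigD1 (Ordinal kN)) //= addrCA lerDl addr_ge0//.
  by apply: sumr_ge0 => j _; rewrite mulr_ge0 ?modulus_ge0 ?exprn_ge0 ?ltW.
have tail h n m : modulus h < rho / 2 -> (n <= m)%N ->
    modulus (\sum_(k < m) a k * h ^+ k - \sum_(k < n) a k * h ^+ k) * rho ^+ n
      <= 2 * M * modulus h ^+ n.
  move=> hr /subnKC <-; move: (m - n)%N => d {m}.
  pose q := modulus h / rho; have hq : modulus h = q * rho by rewrite /q divfK ?gt_eqF.
  have q0 : 0 <= q by rewrite divr_ge0 ?modulus_ge0 ?ltW.
  have q1 : q <= 2^-1 by rewrite ler_pdivrMr//; lra.
  have hn : 0 <= modulus h ^+ n by rewrite exprn_ge0 ?modulus_ge0.
  (* Keeping the exact partial sum of the geometric series of ratio [1/2] lets the induction on [d]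
     close. *)
  suff : modulus (\sum_(k < n + d) a k * h ^+ k - \sum_(k < n) a k * h ^+ k) * rho ^+ n
      <= 2 * M * modulus h ^+ n * (1 - 2^-1 ^+ d).
    move=> /le_trans; apply; apply: ler_piMr; first by rewrite !mulr_ge0 ?(ltW M0).
    by rewrite gerBl exprn_ge0 ?invr_ge0.
  elim: d => [|d IH]; first by rewrite addn0 subrr modulus0 expr0; lra.
  rewrite addnS big_ord_recr /= [_ + a _ * _]addrC -addrA.
  apply: le_trans (ler_wpM2r _ (ler_modulusD _ _)) _; first by rewrite exprn_ge0 ?ltW.
  have : modulus (a (n + d)%N * h ^+ (n + d)) * rho ^+ n <= M * modulus h ^+ n * 2^-1 ^+ d.
    rewrite modulusM modulusX.
    have -> : modulus (a (n + d)%N) * modulus h ^+ (n + d) * rho ^+ n =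
      (modulus (a (n + d)%N) * rho ^+ (n + d)) * modulus h ^+ n * q ^+ d.
      by rewrite hq !exprD !exprMn; ring.
    apply: ler_pM; rewrite ?exprn_ge0//.
    - by rewrite !mulr_ge0 ?exprn_ge0 ?modulus_ge0 ?ltW.
    - exact: ler_wpM2r (aM _).
    - by rewrite lerXn2r ?nnegrE ?invr_ge0.
  rewrite [2^-1 ^+ d.+1]exprS; lra.
have a0 : a 0%N = f z0.
  apply/eqP; rewrite -subr_eq0 -modulus_eq0 eq_le modulus_ge0 andbT.
  apply/ler_addgt0Pr => e e0; rewrite add0r.
  have [|N HN] := fE 0 _ e e0; first by rewrite modulus0.
  have := HN N.+1 (leqnSn N); rewrite addr0 big_ord_recl big1 ?addr0 ?mulr1.
    by rewrite modulusB => /ltW.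
  by move=> i _; rewrite /= /bump /= expr0n mulr0.
(* The quotient of the remainder by [h ^+ n] is completed at [0] by the coefficient [a n]; the
   constants are those of [tail]. *)
exists (rho / 2), (2 * M), rho^-1, (fun n h => if h == 0 then a n else
   (f (z0 + h) - \sum_(k < n) a k * h ^+ k) / h ^+ n).
split=> [|||h hr|n h hr].
- by rewrite divr_gt0.
- lra.
- by rewrite invr_gt0.
- rewrite expr0 divr1 big_ord0 subr0; case: eqVneq => [->|//].
  by rewrite a0 addr0.
split; last first.
  rewrite eqxx; case: eqVneq => [->|h0]; first by rewrite mul0r addr0.
  by rewrite big_ord_recr /= exprS; field; rewrite h0 expf_neq0.
rewrite exprVn; case: eqVneq => [_|h0].
  by rewrite ler_pdivlMr ?exprn_gt0//; have := aM n; lra.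
rewrite modulusM modulusV modulusX ler_pdivlMr ?exprn_gt0// mulrAC.
rewrite ler_pdivrMr ?exprn_gt0 ?modulus_gt0//.
apply/ler_addgt0Pr => e e0.
have hr' : modulus h < r by rewrite /rho in hr; lra.
have rn : 0 < rho ^+ n by rewrite exprn_gt0.
(* A partial sum close enough to [f] carries the bound of [tail] over to the whole remainder, up to
   [e]. *)
have [N HN] := fE h hr' (e / rho ^+ n) (divr_gt0 e0 rn).
have := HN (maxn N n) (leq_maxl _ _).
rewrite ltr_pdivlMr// => h1; have := tail h n (maxn N n) hr (leq_maxr _ _).
set S := \sum_(i < n) _; set T := \sum_(i < maxn N n) _ in h1 * => h2.
have -> : f (z0 + h) - S = (T - S) + (f (z0 + h) - T) by ring.
have := ler_wpM2r (ltW rn) (ler_modulusD (T - S) (f (z0 + h) - T)).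
lra.
Qed.

Lemma derive1_at0 f (l : C) (r K : R) : 0 < r ->
  (forall h, modulus h < r -> modulus (f h - f 0 - l * h) <= K * modulus h ^+ 2) ->
  derive1 (f : C^o -> C^o) 0 = l.
Proof.
move=> r0 fl; rewrite /derive1; apply: cvg_lim; first exact: norm_hausdorff.
apply/cvgrPdist_lt => e e0.
have eE : e = (complex.Re e)%:C%C by rewrite RRe_real// gtr0_real.
have d0 : 0 < complex.Re e by rewrite -ltcR -eE.
have K0 : 0 < `|K| + 1 by rewrite ltr_wpDl.
pose t := Num.min r (complex.Re e / (`|K| + 1)).
have t0 : 0 < t by rewrite lt_min r0 divr_gt0.
near=> h.
have h0 : h != 0 by near: h; exact: nbhs_dnbhs_neq.
have : `|h| < t%:C%C by near: h; apply: dnbhs0_lt; rewrite ltcR.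
rewrite normE ltcR lt_min ltr_pdivlMr// => /andP[hr he].
rewrite addr0 eE normE ltcR; apply: le_lt_trans he.
have -> : l - h^-1 *: (f h - f 0) = - ((f h - f 0 - l * h) / h).
  by rewrite /GRing.scale /=; field.
rewrite modulusN modulusM modulusV ler_pdivrMr ?modulus_gt0//.
apply: le_trans (fl _ hr) _.
rewrite mulrAC -expr2 mulrC; apply: ler_wpM2l; first by rewrite sqr_ge0.
by rewrite (le_trans (ler_norm K))// lerDl.
Unshelve. all: by end_near.
Qed.

End Analytic.

(** * The maximum principle *)

Section MaximumPrinciple.
Variable R : realType.
Local Notation C := R[i].
Implicit Types (f g : C -> C) (z h : C).

(** On [A], both the interior of [P] and the complement of the interior of the complement of [P]
    agree with [P], so the trace of [P] is open and closed in [A]. *)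
Lemma connected_sub (T : topologicalType) (A P : set T) : connected A ->
  (A `&` P !=set0)%classic ->
  (forall x, A x -> P x -> nbhs x P) ->
  (forall x, A x -> ~ P x -> nbhs x (~` P)%classic) ->
  (A `<=` P)%classic.
Proof.
move=> cA AP Po Pc; have <- : (A `&` P = A)%classic; last by move=> x [].
apply: cA => //.
  exists (P°)%classic; first exact: open_interior.
  rewrite predeqE => x; split=> [[Ax Px]|[Ax /interior_subset Px]//].
  by split=> //; apply: Po.
exists (~` (~` P)°)%classic; first exact/open_closedC/open_interior.
rewrite predeqE => x; split=> [[Ax Px]|[Ax nPx]].
  by split=> // /interior_subset.
by split=> //; apply: contrapT => /(Pc x Ax).
Qed.

(** Connectedness is only used for [[0, 1]], pulled back along the segment from [c] to [q]; disks
    being convex, this suffices to spread a local property. *)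
Lemma segment_sub (P : C -> Prop) (c q : C) : P c ->
  (forall t : R, 0 <= t <= 1 -> P (c + t%:C%C * (q - c)) ->
    exists2 d : R, 0 < d & forall z, modulus (z - (c + t%:C%C * (q - c))) < d -> P z) ->
  (forall t : R, 0 <= t <= 1 -> ~ P (c + t%:C%C * (q - c)) ->
    exists2 d : R, 0 < d & forall z, modulus (z - (c + t%:C%C * (q - c))) < d -> ~ P z) ->
  P q.
Proof.
move=> Pc Po Pn; pose Q := [set t : R | P (c + t%:C%C * (q - c))]%classic.
suff near t (A : set C) : (exists2 d : R, 0 < d & forall z,
    modulus (z - (c + t%:C%C * (q - c))) < d -> A z) ->
    nbhs t [set t : R | A (c + t%:C%C * (q - c))]%classic.
  have : (`[0%R, 1%R] `<=` Q)%classic.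
    apply: connected_sub; first exact: segment_connected.
    + exists 0; split; first by rewrite /= in_itv /= lexx ler01.
      by rewrite /Q /mkset rmorph0 mul0r addr0.
    + by move=> t /=; rewrite in_itv /= => t01 Pt; apply: near; exact: Po.
    + move=> t /=; rewrite in_itv /= => t01 Pt.
      by apply: (near t (fun z => ~ P z)); exact: Pn.
  move=> /(_ 1); rewrite /Q /mkset rmorph1 mul1r addrCA subrr addr0.
  by apply; rewrite in_itv /= lexx ler01.
move=> [d d0 H]; apply/nbhs_ballP.
have K0 : 0 < modulus (q - c) + 1 by rewrite ltr_wpDl ?modulus_ge0.
exists (d / (modulus (q - c) + 1)); first by rewrite /= divr_gt0.
move=> t' /=; rewrite /ball /= ltr_pdivlMr// => tt'; apply: H.
have -> : c + t'%:C%C * (q - c) - (c + t%:C%C * (q - c)) = (t' - t)%:C%C * (q - c).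
  by rewrite rmorphB /=; ring.
have -> : modulus ((t' - t)%:C%C * (q - c)) = `|t - t'| * modulus (q - c).
  rewrite modulusM; congr (_ * _); rewrite distrC.
  by apply: complexI; rewrite -normE; rewrite normc_def /= expr0n addr0 sqrtr_sqr.
by apply: le_lt_trans tt'; apply: ler_wpM2l; rewrite ?normr_ge0// lerDl.
Qed.

(** Seen in [R * R], the closed disk is a closed subset of a compact square. *)
Lemma EVT_disk (u : C -> R) (rho : R) : 0 <= rho ->
  (forall z, modulus z <= rho -> forall e, 0 < e -> exists2 d : R, 0 < d &
    forall y, modulus (y - z) < d -> `|u y - u z| < e) ->
  exists2 c, modulus c <= rho & forall z, modulus z <= rho -> u z <= u c.
Proof.
move=> rho0 uc.
pose A := [set p : R * R | p.1 ^+ 2 + p.2 ^+ 2 <= rho ^+ 2]%classic.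
pose ofp (p : R * R) : C := (p.1 +i* p.2)%C.
have modE z : modulus z ^+ 2 = complex.Re z ^+ 2 + complex.Im z ^+ 2.
  by apply: complexI; rewrite add_Re2_Im2 normE rmorphXn.
have AE p : A p <-> modulus (ofp p) <= rho.
  by rewrite /A /= -[X in _ <-> is_true X](@ler_sqr R) ?nnegrE ?modulus_ge0// modE.
have Acl : closed A.
  have -> : A = ((fun p : R * R => p.1 * p.1 + p.2 * p.2) @^-1` [set x | x <= rho ^+ 2])%classic.
    by rewrite /A predeqE => p /=; rewrite !expr2.
  apply: closed_comp; last exact: closed_le.
  move=> p _; apply: cvgD; apply: cvgM; try exact: cvg_fst; exact: cvg_snd.
have Aco : compact A.
  apply: (subclosed_compact Acl (compact_setX (@segment_compact R (- rho) rho)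
                                              (@segment_compact R (- rho) rho))).
  move=> p /=; rewrite /A !in_itv /= -!ler_norml => Ap.
  split; rewrite -(@ler_sqr R) ?nnegrE// real_normK ?num_real//.
    by apply: le_trans Ap; rewrite lerDl sqr_ge0.
  by apply: le_trans Ap; rewrite lerDr sqr_ge0.
have [||p] := @compact_EVT_max _ R (u \o ofp) A _ Aco.
- by exists (0, 0); rewrite /A /= !expr0n addr0 sqr_ge0.
- apply: continuous_in_subspaceT => p; rewrite inE => /AE pA.
  apply/cvgrPdist_lt => e e0; have [d d0 H] := uc _ pA e e0.
  exists (ball p.1 (d / 2), ball p.2 (d / 2)) => [|y].
    by split; apply: nbhsx_ballx; rewrite divr_gt0.
  rewrite /= /ball /= => -[y1 y2]; rewrite distrC; apply: H.
  apply: (@le_lt_trans _ _ (`|p.1 - y.1| + `|p.2 - y.2|)); last lra.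
  rewrite modulusB -ler_sqr ?nnegrE ?modulus_ge0 ?addr_ge0// modE /=.
  rewrite -(real_normK (num_real (p.1 - y.1))) -(real_normK (num_real (p.2 - y.2))).
  have : 0 <= `|p.1 - y.1| * `|p.2 - y.2| by rewrite mulr_ge0.
  lra.
rewrite inE => /AE pA pmax; exists (ofp p) => // z zr.
have := pmax (complex.Re z, complex.Im z); rewrite inE /=.
by rewrite /ofp /=; case: z zr => x y zr; apply; apply/AE.
Qed.

(** Were the maximum over the closed disk, attained at [c], larger than [B], all points where
    [|g| = |g c|] would be interior. Along the segment from [c] to the boundary point [rho], these
    points form an open set by [local_max] and a closed one by continuity, so [rho] would be one of
    them. *)
Lemma weak_max g (rho B : R) y : (forall z, unit_disk R z -> ana g z) ->
  0 < rho < 1 -> (forall z, modulus z = rho -> modulus (g z) <= B) ->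
  modulus y <= rho -> modulus (g y) <= B.
Proof.
move=> ga /andP[rho0 rho1] gB yr.
have cont z : modulus z <= rho -> forall e, 0 < e -> exists2 d : R, 0 < d &
    forall y, modulus (y - z) < d -> `|modulus (g y) - modulus (g z)| < e.
  move=> zr e e0; have [|r [K [r0 K0 gK]]] := ana_cont (ga z _).
    by apply/in_diskE; lra.
  exists (Num.min r (e / K)); first by rewrite lt_min r0 divr_gt0.
  move=> x; rewrite lt_min ltr_pdivlMr// => /andP[/gK xr].
  rewrite mulrC; apply: le_lt_trans; apply: le_trans xr.
  have := modulus_split (g z) (g x); have := modulus_split (g x) (g z).
  by rewrite [modulus (g z - _)]modulusB ler_norml; lra.
have [c cr cmax] := EVT_disk (ltW rho0) cont.
apply: le_trans (cmax _ yr) _; rewrite leNgt; apply/negP => Bc.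
have qr : modulus rho%:C%C = rho by rewrite modulusR// ltW.
have seg (t : R) : 0 <= t <= 1 -> modulus (c + t%:C%C * (rho%:C%C - c)) <= rho.
  move=> /andP[t0 t1].
  have -> : c + t%:C%C * (rho%:C%C - c) = (1 - t)%:C%C * c + t%:C%C * rho%:C%C.
    by rewrite rmorphB rmorph1; ring.
  apply: le_trans (ler_modulusD _ _) _; rewrite !modulusM qr !modulusR//; last lra.
  have : (1 - t) * modulus c <= (1 - t) * rho by apply: ler_wpM2l => //; lra.
  lra.
have : modulus (g rho%:C%C) = modulus (g c).
  apply: (@segment_sub (fun z => modulus (g z) = modulus (g c)) c rho%:C%C) => //.
    move=> t /seg; set z := c + _ => zr gz.
    have zr' : modulus z < rho.
      by rewrite lt_neqAle zr andbT; apply/eqP => /gB; lra.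
    have [||z' z'r|r' r'0 H] := @local_max _ g z (rho - modulus z).
    - by apply: ga; apply/in_diskE; lra.
    - lra.
    - rewrite gz; apply: cmax; have := modulus_split z z'; lra.
    by exists r' => // x /H ->.
  move=> t /seg; set z := c + _ => zr /eqP gz.
  have [|d d0 H] := cont z zr (`|modulus (g c) - modulus (g z)|).
    by rewrite normr_gt0 subr_eq0 eq_sym.
  by exists d => // x /H + gx; rewrite gx ltxx.
by have := gB _ qr; lra.
Qed.

(** Along the segment from [p] to [q], the set where [f = f p] is open by [local_max] and closed by
    continuity. *)
Lemma strong_max f p : (forall z, unit_disk R z -> ana f z) -> unit_disk R p ->
  (forall z, unit_disk R z -> modulus (f z) <= modulus (f p)) ->
  forall q, unit_disk R q -> f q = f p.
Proof.
move=> fa /in_diskE pD fmax q /in_diskE qD.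
have seg (t : R) : 0 <= t <= 1 -> modulus (p + t%:C%C * (q - p)) < 1.
  move=> /andP[t0 t1].
  have -> : p + t%:C%C * (q - p) = (1 - t)%:C%C * p + t%:C%C * q.
    by rewrite rmorphB rmorph1; ring.
  apply: le_lt_trans (ler_modulusD _ _) _; rewrite !modulusM !modulusR//; last lra.
  set m := Num.max (modulus p) (modulus q).
  have m1 : m < 1 by rewrite gt_max pD.
  have pm : modulus p <= m by rewrite le_max lexx.
  have qm : modulus q <= m by rewrite le_max lexx orbT.
  have t1' : 0 <= 1 - t by lra.
  have := ler_wpM2l t0 qm; have := ler_wpM2l t1' pm; lra.
apply: (@segment_sub (fun z => f z = f p) p q) => //.
  move=> t /seg; set z := p + _ => zD fz.
  have [||z' z'r|r' r'0 H] := @local_max _ f z (1 - modulus z).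
  - by apply: fa; apply/in_diskE.
  - lra.
  - rewrite fz; apply: fmax; apply/in_diskE; have := modulus_split z z'; lra.
  by exists r' => // x /H ->.
move=> t /seg; set z := p + _ => zD /eqP fz.
have [|r [K [r0 K0 fK]]] := ana_cont (fa z _); first exact/in_diskE.
have dz : 0 < modulus (f p - f z) by rewrite modulus_gt0 subr_eq0 eq_sym.
exists (Num.min r (modulus (f p - f z) / K)); first by rewrite lt_min r0 divr_gt0.
move=> x; rewrite lt_min ltr_pdivlMr// => /andP[/fK xr xd] fx.
by rewrite fx in xr; lra.
Qed.

End MaximumPrinciple.

(** * Schur functions *)

Section SchurClass.
Variable R : realType.
Local Notation C := R[i].
Implicit Types (f g : C -> C) (a u v x z : C).

Definition schur f := (forall z, unit_disk R z -> ana f z) /\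
  (forall z, unit_disk R z -> modulus (f z) <= 1).

Lemma disk_den_neq0 a u : modulus a * modulus u < 1 -> 1 - a^* * u != 0.
Proof.
move=> au1; rewrite subr_eq0; apply/eqP => e1.
by move: au1; rewrite -(modulusJ a) -modulusM -e1 modulus1 ltxx.
Qed.

Lemma disk_den_neq0W a u : modulus a < 1 -> modulus u <= 1 -> 1 - a^* * u != 0.
Proof.
move=> a1 u1; apply: disk_den_neq0; have := modulus_ge0 a.
have := modulus_ge0 u; nra.
Qed.

(** This comparison of denominator and numerator bounds [disk_aut a] by [1]; in [schwarz] it
    measures how close the modulus of [disk_aut x] is to [1] near the unit circle. *)
Lemma modulus_disk_den a u :
  modulus (1 - a^* * u) ^+ 2 =
  modulus (u - a) ^+ 2 + (1 - modulus a ^+ 2) * (1 - modulus u ^+ 2).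
Proof.
apply: complexI; rewrite rmorphD [X in _ = _ + X]rmorphM !rmorphB !rmorph1 /= !modulus_sqr.
rewrite !rmorphB !rmorphM rmorph1 /= conjCK; ring.
Qed.

Lemma modulus_disk_aut a u : modulus a < 1 -> modulus u <= 1 ->
  modulus (disk_aut a u) <= 1.
Proof.
move=> a1 u1; rewrite modulusM modulusV.
rewrite ler_pdivrMr ?modulus_gt0 ?disk_den_neq0W// mul1r.
rewrite -ler_sqr ?nnegrE ?modulus_ge0// modulus_disk_den lerDl.
by rewrite mulr_ge0// subr_ge0 expr_le1// ?modulus_ge0// ltW.
Qed.

Lemma disk_aut_self a : disk_aut a a = 0.
Proof. by rewrite /disk_aut subrr mul0r. Qed.

Lemma disk_autK a u : modulus a < 1 -> modulus u <= 1 ->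
  disk_aut (- a) (disk_aut a u) = u.
Proof.
move=> a1 u1; have := disk_den_neq0W a1 u1.
have := disk_den_neq0W a1 (ltW a1); rewrite /disk_aut rmorphN /=.
set b := a^* => ba bu; field; rewrite bu /=.
by apply: contra ba => /eqP <-; apply/eqP; ring.
Qed.

Lemma schur_cst a : modulus a <= 1 -> schur (fun=> a).
Proof. by move=> a1; split=> z // _; exact: ana_cst. Qed.

Lemma schurM f g : schur f -> schur g -> schur (fun z => f z * g z).
Proof.
move=> [fa f1] [ga g1]; split=> z zD; first by apply: anaM; [exact: fa|exact: ga].
by rewrite modulusM -[leRHS]mulr1 ler_pM ?modulus_ge0 ?f1 ?g1.
Qed.

Lemma schur_disk_aut f a : unit_disk R a -> schur f ->
  schur (fun z => disk_aut a (f z)).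
Proof.
move=> /in_diskE a1 [fa f1]; split=> z zD; last exact: modulus_disk_aut (f1 _ zD).
apply: anaM; first by apply: anaD; [exact: fa|exact: ana_cst].
have den : ana (fun z => 1 - a^* * f z) z.
  have -> : (fun z => 1 - a^* * f z) = (fun z => 1 + (- a^*) * f z).
    by apply/funext => y; rewrite mulNr.
  apply: anaD; first exact: ana_cst.
  by apply: anaM; [exact: ana_cst|exact: fa].
by apply: (anaV _ den); exact: disk_den_neq0W (f1 z zD).
Qed.

Lemma schur_id : schur id.
Proof. by split=> z zD; [exact: ana_id|apply/ltW/in_diskE]. Qed.

(** On the circle of radius [1 - d], [modulus_disk_den] turns [|g|^2] into
    [|f|^2 + |k|^2 (1 - |x|^2) (1 - |z|^2)], whose last term is of order [d]. The bound passes to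
    the inside by [weak_max], and [d] is arbitrarily small. *)
Lemma schwarz f x : schur f -> unit_disk R x -> f x = 0 ->
  exists2 g, schur g & forall z, unit_disk R z -> f z = disk_aut x z * g z.
Proof.
move=> [fa f1] xD fx; have [k [ka fk]] := ana_div fa xD.
have /in_diskE x1 := xD.
pose g z := k z * (1 - x^* * z).
have fg z : unit_disk R z -> f z = disk_aut x z * g z.
  move=> /in_diskE z1; rewrite fk fx add0r /disk_aut /g.
  by have := disk_den_neq0W x1 (ltW z1) => den; field.
have ga z : unit_disk R z -> ana g z.
  move=> zD; apply: anaM; first exact: ka.
  have -> : (fun z => 1 - x^* * z) = (fun z => 1 + (- x^*) * z).
    by apply/funext => y; rewrite mulNr.
  apply: anaD; first exact: ana_cst.
  by apply: anaM; [exact: ana_cst|exact: ana_id].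
exists g => //; split=> // y /in_diskE y1.
apply/ler_addgt0Pr => e e0.
pose eta := 1 - modulus x; have eta0 : 0 < eta by rewrite subr_gt0.
have x0 := modulus_ge0 x; have y0 := modulus_ge0 y.
(* The three bounds give, in turn: [|z - x| >= eta / 2] on the circle, whence [|k| <= 2 / eta]; [y]
   inside the circle; an error [(4 / eta ^+ 2) * (2 * d)] at most [e]. *)
pose d := Num.min (Num.min (eta / 2) (1 - modulus y)) (e * eta ^+ 2 / 8).
have ee0 : 0 < e * eta ^+ 2 / 8 by rewrite !mulr_gt0// ?invr_gt0// exprn_gt0.
have d0 : 0 < d by rewrite !lt_min subr_gt0 y1 ee0 divr_gt0.
have [d1 d2 d3] : [/\ d <= eta / 2, d <= 1 - modulus y & d <= e * eta ^+ 2 / 8].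
  by rewrite /d !ge_min !lexx !orbT.
apply: (@weak_max _ g (1 - d)) => //; [by rewrite /eta in d1; lra| |lra].
move=> z zd; have z1 : modulus z < 1 by rewrite zd; lra.
have fz : modulus (z - x) * modulus (k z) <= 1.
  by rewrite -modulusM; have := f1 z; rewrite fk fx add0r; apply; apply/in_diskE.
have zx : eta / 2 <= modulus (z - x).
  have := ler_modulusB z (- x); rewrite modulusN zd; rewrite /eta in d1 *; lra.
have k0 := modulus_ge0 (k z).
have keta : modulus (k z) * eta <= 2.
  have := ler_wpM2r k0 zx; lra.
have : modulus (g z) ^+ 2 <= 1 + e.
  rewrite modulusM exprMn modulus_disk_den mulrDr -exprMn.
  apply: lerD.
    by rewrite mulrC expr_le1// mulr_ge0 ?modulus_ge0.
  have A4 : modulus (k z) ^+ 2 * eta ^+ 2 <= 4.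
    have -> : 4 = 2 ^+ 2 :> R by ring.
    by rewrite -exprMn ler_sqr ?nnegrE ?mulr_ge0// ltW.
  have A0 := sqr_ge0 (modulus (k z)).
  have PQ : (1 - modulus x ^+ 2) * (1 - modulus z ^+ 2) <= 2 * d.
    have := sqr_ge0 d; have x2 := sqr_ge0 (modulus x); rewrite zd => dd.
    have : modulus x ^+ 2 * (d * (2 - d)) >= 0 by rewrite !mulr_ge0//; lra.
    lra.
  apply: le_trans (ler_wpM2l A0 PQ) _.
  have := ler_wpM2l A0 d3; have := ler_wpM2l (ltW e0) A4; lra.
move=> g2; rewrite -ler_sqr ?nnegrE ?modulus_ge0//; last lra.
apply: le_trans g2 _; nra.
Qed.

End SchurClass.

(** * The Nevanlinna-Pick theorem *)

(* Both sides of [1 - phi_a(u) phi_a(v)^*] are rescalings of [1 - u v^*]; this is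
   used once for the values [u], [v] and once for the nodes [y], [y']. *)
Lemma schur_kernelE (R : realType) (a x u v y y' : R[i]) :
  1 - a^* * a != 0 -> 1 - a^* * u != 0 -> 1 - a^* * v != 0 ->
  1 - x^* * y != 0 -> 1 - x^* * y' != 0 -> 1 - y * y'^* != 0 ->
  (1 - u * v^*) / (1 - y * y'^*) =
  (1 - a^* * a)^-1 * ((1 - a^* * u) * (1 - a^* * v)^*) *
  ((1 - x * x^*) / ((1 - x^* * y) * (1 - x^* * y')^*) +
   (disk_aut x y * (disk_aut x y')^* - disk_aut a u * (disk_aut a v)^*)
     / (1 - y * y'^*)).
Proof.
have conj_den b t : (1 - b^* * t)^* = 1 - b * t^* :> R[i].
  by rewrite rmorphB rmorph1 rmorphM /= conjCK.
move=> aa au; rewrite -conjC_eq0 conj_den => av xy; rewrite -conjC_eq0 conj_den => xy' yy.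
rewrite /disk_aut !(rmorphM, fmorphV) /= !conj_den !rmorphB /=.
by field; rewrite aa au av xy xy' yy.
Qed.

Section Pick.
Variables (R : realType) (I : eqType) (z : I -> R[i]).
Local Notation C := R[i].
Implicit Types (s t : seq I) (w g c : I -> C) (a x : C).
Hypothesis z_disk : forall i, unit_disk R (z i).

(** Indexing by a list lets Schur's algorithm discard a node by passing to the tail. *)
Definition pick_form s w c : C :=
  \sum_(i <- s) \sum_(j <- s)
    c i * (c j)^* * ((1 - w i * (w j)^*) / (1 - z i * (z j)^*)).

Definition pick_psd s w := forall c, 0 <= pick_form s w c.

Let z1 i : modulus (z i) < 1. Proof. exact/in_diskE. Qed.

Let zz_neq0 i j : 1 - z i * (z j)^* != 0.
Proof.
rewrite mulrC disk_den_neq0//; have := modulus_ge0 (z i); have := modulus_ge0 (z j).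
have := z1 i; have := z1 j; nra.
Qed.

(** Summation of [schur_kernelE]: its first term factors into a squared modulus, the rank one part.
    The new vector carries the factor [disk_aut x (z i)], which vanishes at the node [x] and so
    removes it from the form of [g]. *)
Lemma pick_form_schur t w g c a x : modulus a < 1 -> modulus x < 1 ->
  (forall i, i \in t -> modulus (w i) <= 1) ->
  (forall i, i \in t -> disk_aut a (w i) = disk_aut x (z i) * g i) ->
  let d i := c i * (1 - a^* * w i) in
  pick_form t w c = (1 - a * a^*)^-1 *
    ((1 - x * x^*) * ((\sum_(i <- t) d i / (1 - x^* * z i)) *
                      (\sum_(i <- t) d i / (1 - x^* * z i))^*)
     + pick_form t g (fun i => d i * disk_aut x (z i))).
Proof.
move=> a1 x1 w1 wg d; rewrite rmorph_sum /= big_distrlr /= mulr_sumr.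
rewrite -big_split mulr_sumr /=; apply: eq_big_seq => i it.
rewrite mulr_sumr -big_split mulr_sumr /=; apply: eq_big_seq => j jt.
have := wg j jt; have := wg i it.
have den := disk_den_neq0W a1 (ltW a1).
have di := disk_den_neq0W a1 (w1 i it); have dj := disk_den_neq0W a1 (w1 j jt).
have ei := disk_den_neq0W x1 (ltW (z1 i)); have ej := disk_den_neq0W x1 (ltW (z1 j)).
move=> gi gj; rewrite (schur_kernelE den di dj ei ej (zz_neq0 i j)) gi gj /d.
move: den ei ej (zz_neq0 i j); rewrite -(conjC_eq0 (1 - x^* * z j)).
have -> : 1 - a^* * a = 1 - a * a^* by rewrite mulrC.
move: (1 - a * a^*) (1 - x * x^*) (1 - a^* * w i) (1 - a^* * w j) => A X al al'.
move: (1 - x^* * z i) (1 - x^* * z j) (1 - z i * (z j)^*) => e e' zz.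
move: (disk_aut x (z i)) (disk_aut x (z j)) => b b' A0 e0 e0' zz0.
by rewrite !(rmorphM, fmorphV) /=; field; rewrite e0 zz0 e0' A0.
Qed.

Lemma pick_form_cons0 i s w c : c i = 0 -> pick_form (i :: s) w c = pick_form s w c.
Proof.
move=> ci; rewrite /pick_form big_cons big1 => [|j _]; last by rewrite ci !mul0r.
by rewrite add0r; apply: eq_bigr => j _; rewrite big_cons ci rmorph0 mulr0 mul0r add0r.
Qed.

Lemma pick_psd_sub s t w : uniq s -> uniq t -> {subset s <= t} ->
  pick_psd t w -> pick_psd s w.
Proof.
move=> us ut st psd c; pose c' i := if i \in s then c i else 0.
have sumE (F : I -> C) : \sum_(i <- t) (if i \in s then F i else 0) = \sum_(i <- s) F i.
  rewrite -big_mkcond -big_filter; apply: perm_big.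
  apply: uniq_perm => [||i]; rewrite ?filter_uniq// mem_filter.
  by apply: andb_idr; exact: st.
have := psd c'; congr (0 <= _); rewrite /pick_form -sumE; apply: eq_bigr => i _.
rewrite /c'; case: ifP => is_; last by rewrite big1// => j _; rewrite !mul0r.
rewrite -sumE; apply: eq_bigr => j _; case: ifP => //.
by rewrite rmorph0 mulr0 mul0r.
Qed.

Let defect_ge0 i : 0 < 1 - z i * (z i)^*.
Proof.
rewrite -modulus_sqr -[X in X - _](rmorph1 (real_complex R)) -rmorphB ltcR subr_gt0.
by rewrite expr_lt1// ?modulus_ge0// z1.
Qed.

Lemma pick_psd_diag s w i : uniq s -> i \in s -> pick_psd s w -> modulus (w i) <= 1.
Proof.
move=> us is_ psd; have sub : {subset [:: i] <= s} by move=> j; rewrite inE => /eqP ->.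
have := pick_psd_sub (isT : uniq [:: i]) us sub psd (fun=> 1).
rewrite /pick_form !big_seq1 rmorph1 !mul1r pmulr_lge0 ?invr_gt0//.
rewrite -modulus_sqr -[X in X - _](rmorph1 (real_complex R)) -rmorphB ler0c subr_ge0.
by rewrite expr_le1// modulus_ge0.
Qed.

(** In the form at [i] and [j] the diagonal entry at [i] is zero, which forces the off-diagonal
    entry [k] to vanish; then [w i * (w j)^* = 1]. *)
Lemma pick_psd_rigid s w i j : uniq s -> i \in s -> j \in s -> pick_psd s w ->
  modulus (w i) = 1 -> w j = w i.
Proof.
move=> us is_ js psd wi1; have [->//|ji] := eqVneq j i.
have {}psd : pick_psd [:: i; j] w.
  apply: pick_psd_sub psd => //=; first by rewrite inE eq_sym ji.
  by move=> k; rewrite !inE => /orP[] /eqP ->.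
have wii : w i * (w i)^* = 1 by rewrite -modulus_sqr wi1 expr1n rmorph1.
pose k := (1 - w i * (w j)^*) / (1 - z i * (z j)^*).
have kJ : (1 - w j * (w i)^*) / (1 - z j * (z i)^*) = k^*.
  rewrite /k !(rmorphM, fmorphV) /= !rmorphB rmorph1 !rmorphM /= !conjCK.
  by rewrite [(w i)^* * _]mulrC [(z i)^* * _]mulrC.
suff k0 : k = 0.
  have : 1 - w i * (w j)^* = 0.
    by apply: (mulIf (invr_neq0 (zz_neq0 i j))); rewrite mul0r.
  move=> /(congr1 ( *%R (w i)^*)); rewrite mulr0 mulrBr mulr1 mulrA.
  rewrite [_ * w i]mulrC wii mul1r => /subr0_eq /(congr1 Num.conj).
  by rewrite !conjCK.
pose kj := (1 - w j * (w j)^*) / (1 - z j * (z j)^*).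
suff : 2 * modulus k ^+ 2 <= 0.
  move=> k2; apply/eqP; rewrite -modulus_eq0 -sqrf_eq0 eq_le sqr_ge0 andbT; lra.
apply: (@le0_geometric _ _ (complex.Re kj)) => n.
(* This vector gives the form the value [kj - 2 * 2 ^+ n * |k| ^+ 2], which stays nonnegative for
   all [n] only if [k = 0]. *)
have := psd (fun l => if l == i then - (2 ^+ n * k^*) else 1).
rewrite /pick_form !big_cons !big_nil !addr0 eqxx (negbTE ji) -/k -/kj kJ.
rewrite wii subrr mul0r mulr0 add0r.
have -> : (- (2 ^+ n * k^*))^* = - (2 ^+ n * k).
  by rewrite rmorphN /= [(_ * k^*)^*]rmorphM rmorphXn /= conjC_nat conjCK.
rewrite rmorph1 !mul1r mulr1.
clearbody k kj; have -> : - (2 ^+ n * k^*) * k + (- (2 ^+ n * k) * k^* + kj) =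
    kj - (2 * modulus k ^+ 2 * 2 ^+ n)%:C%C.
  have k2 : (2 * modulus k ^+ 2)%:C%C = 2 * (k * k^*).
    by rewrite -modulus_sqr rmorphM rmorph_nat.
  by rewrite rmorphM /= k2 rmorphXn /= rmorph_nat; ring.
case: kj => kr ki; rewrite lecE /= => /andP[_]; lra.
Qed.

(** Induction on the nodes. A value of modulus [1] makes [f] constant by [strong_max], and the form
    is zero; otherwise one Schur step at the first node leaves the form of [g] at the others. *)
Lemma pick_necessity s f : schur f -> pick_psd s (fun i => f (z i)).
Proof.
elim: s f => [|i s IH] f [fa f1] c; first by rewrite /pick_form big_nil.
have := f1 _ (z_disk i); rewrite le_eqVlt => /orP[/eqP fi|fi].
  have fE j : f (z j) = f (z i).
    apply: strong_max => // y yD; rewrite fi; exact: f1.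
  rewrite /pick_form big1// => j _; rewrite big1// => k _.
  by rewrite !fE -modulus_sqr fi expr1n rmorph1 subrr mul0r mulr0.
have [|g gS fg] := schwarz (schur_disk_aut (proj2 (in_diskE _) fi) (conj fa f1)) (z_disk i).
  exact: disk_aut_self.
have := @pick_form_schur (i :: s) (fun i => f (z i)) (fun i => g (z i)) c _ _ fi (z1 i).
move=> /(_ (fun j _ => f1 _ (z_disk j)) (fun j _ => fg _ (z_disk j))) /= ->.
rewrite mulr_ge0//.
  rewrite invr_ge0 -modulus_sqr -[X in X - _](rmorph1 (real_complex R)) -rmorphB ler0c subr_ge0.
  by rewrite expr_le1 ?modulus_ge0 ?ltW.
rewrite addr_ge0//; first by rewrite mulr_ge0 ?mul_conjC_ge0// ltW.
by rewrite pick_form_cons0; [exact: IH|rewrite disk_aut_self mulr0].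
Qed.

(** Schur's step run backwards: the data [g] at the remaining nodes inherit positivity, and an
    interpolant [h] of them gives back one of [w]. If the first value has modulus [1],
    [pick_psd_rigid] makes the data constant. *)
Lemma pick_sufficiency s w : injective z -> uniq s -> pick_psd s w ->
  exists2 f, schur f & forall i, i \in s -> f (z i) = w i.
Proof.
move=> z_inj; elim: s w => [|i s IH] w.
  by exists (fun=> 0) => //; apply: schur_cst; rewrite modulus0.
move=> us psd; have w1 j : j \in i :: s -> modulus (w j) <= 1.
  by move=> js; exact: pick_psd_diag psd.
have ii : i \in i :: s by rewrite mem_head.
have := w1 i ii; rewrite le_eqVlt => /orP[/eqP wi|wi].
  exists (fun=> w i); first by apply: schur_cst; rewrite wi.
  by move=> j js; rewrite (pick_psd_rigid us ii js psd wi).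
have /= /andP[is_ us'] := us.
(* At [i] the quotient [g] is [0 / 0], that is [0]; both sides of [wg] vanish there. *)
pose a := w i; pose x := z i; pose g j := disk_aut a (w j) / disk_aut x (z j).
have b0 j : j \in s -> disk_aut x (z j) != 0.
  move=> js; rewrite mulf_eq0 invr_eq0 negb_or (disk_den_neq0W (z1 i) (ltW (z1 j))) andbT.
  rewrite subr_eq0; apply: contra is_ => /eqP/z_inj <- //.
have wg j : j \in i :: s -> disk_aut a (w j) = disk_aut x (z j) * g j.
  rewrite inE => /predU1P[->|js]; first by rewrite !disk_aut_self mul0r.
  by rewrite mulrC divfK ?b0.
have [||h hS hg] := IH g => //.
  move=> d.
  pose al j := 1 - a^* * w j; pose e j := 1 - x^* * z j.
  have al0 j : j \in i :: s -> al j != 0 by move=> /w1; exact: disk_den_neq0W.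
  have e0 j : e j != 0 by exact: (disk_den_neq0W (z1 i) (ltW (z1 j))).
  pose c0 j := d j / (al j * disk_aut x (z j)).
  (* The coefficient at [i] is chosen to cancel the rank one part, while [c0] makes the rescaled
     vector equal to [d] on [s]. *)
  pose c j := if j == i then - (\sum_(k <- s) c0 k * al k / e k) * e i / al i else c0 j.
  have cs j : j \in s -> c j = c0 j.
    by move=> js; rewrite /c; case: eqVneq js is_ => // -> ->.
  have := psd c; rewrite (pick_form_schur _ wi (z1 i) w1 wg).
  have -> : \sum_(j <- i :: s) c j * al j / e j = 0.
    rewrite big_cons (eq_big_seq (fun k => c0 k * al k / e k)) => [|j /cs -> //].
    rewrite {1}/c eqxx; set S := \sum_(k <- s) _.
    by field; rewrite e0 al0.
  rewrite mul0r mulr0 add0r pick_form_cons0; last by rewrite disk_aut_self mulr0.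
  rewrite pmulr_rge0; last first.
    rewrite invr_gt0 -modulus_sqr -[X in X - _](rmorph1 (real_complex R)) -rmorphB ltcR subr_gt0.
    by rewrite expr_lt1 ?modulus_ge0.
  congr (0 <= _); rewrite /pick_form; apply: eq_big_seq => j js; apply: eq_big_seq => k ks.
  have dE l : l \in s -> c l * al l * disk_aut x (z l) = d l.
    move=> ls; rewrite cs// /c0; field.
    by rewrite b0// al0// inE ls orbT.
  by rewrite !dE.
exists (fun y => disk_aut (- a) (disk_aut x y * h y)).
  apply: schur_disk_aut; first by apply/in_diskE; rewrite modulusN.
  by apply: schurM hS; exact: (schur_disk_aut (z_disk i) (@schur_id R)).
move=> j js; have -> : disk_aut x (z j) * h (z j) = disk_aut a (w j).
  move: (js); rewrite inE => /predU1P[->|js']; first by rewrite !disk_aut_self mul0r.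
  by rewrite hg// -wg.
exact: disk_autK wi (w1 j js).
Qed.

End Pick.

(** * The constrained problem *)

Section Constrained.
Variable R : realType.
Local Notation C := R[i].
Implicit Types (f g h : C -> C) (lambda z : C).

(** The bound contained in [Hinfty] makes [sup] an actual upper bound; in the other direction the
    value at [0] shows that the set of moduli is nonempty. *)
Lemma schurE f : schur f <-> Hinfty f /\ Hinfty_norm f <= 1.
Proof.
split=> [[fa f1]|[[fa [M fM]] f1]].
  split; first split.
  - by move=> z /fa /analytic_atE.
  - by exists 1.
  apply: ge_sup; last by move=> _ [z zD <-]; exact: f1.
  by exists (modulus (f 0)), 0 => //; apply/in_diskE; rewrite modulus0.
split=> z zD; first by apply/analytic_atE; exact: fa.
apply: le_trans f1; apply: ub_le_sup; last by exists z.
by exists M => _ [y yD <-]; exact: fM.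
Qed.

Let zero_disk : unit_disk R 0. Proof. by apply/in_diskE; rewrite modulus0. Qed.

Lemma disk_aut0 z : disk_aut 0 z = z.
Proof. by rewrite /disk_aut subr0 rmorph0 mul0r subr0 divr1. Qed.

Lemma disk_autN_sub lambda z : modulus lambda < 1 -> modulus z <= 1 ->
  disk_aut (- lambda) z - lambda =
  (1 - lambda * lambda^*) * z / (1 + lambda^* * z).
Proof.
move=> l1 z1; have : 1 - (- lambda)^* * z != 0.
  by apply: disk_den_neq0W; rewrite ?modulusN.
by rewrite /disk_aut rmorphN /= mulNr !opprK => den; field.
Qed.

(* Chain rule: [1 - lambda * lambda^*] is the derivative of [phi_(-lambda)] at [0]. *)
Lemma derive1_disk_aut f lambda g : unit_disk R lambda -> schur g ->
  (forall z, unit_disk R z -> f z = disk_aut (- lambda) (z * g z)) ->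
  derive1 (f : C^o -> C^o) 0 = (1 - lambda * lambda^*) * g 0.
Proof.
move=> /in_diskE l1 [ga g1] fg; have [r [K [r0 K0 gK]]] := ana_cont (ga _ zero_disk).
have d0 : 0 < 1 - modulus lambda by rewrite subr_gt0.
apply: (@derive1_at0 _ _ _ (Num.min r 1) ((K + 1) / (1 - modulus lambda))).
  by rewrite lt_min r0 ltr01.
move=> h; rewrite lt_min => /andP[hr h1].
have gh := g1 h (proj2 (in_diskE h) h1); have g0 := g1 _ zero_disk.
have h0 := modulus_ge0 h; have l0 := modulus_ge0 lambda.
have hgh : modulus (h * g h) <= 1 by rewrite modulusM mulr_ile1 ?modulus_ge0// ltW.
have hgh' : modulus (h * g h) <= modulus h by rewrite modulusM ler_piMr.
have den : 1 - modulus lambda <= modulus (1 + lambda^* * (h * g h)).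
  have := ler_modulusB 1 (lambda^* * (h * g h)); rewrite modulus1 modulusM modulusJ.
  have := ler_piMr l0 hgh; lra.
have dn : 1 + lambda^* * (h * g h) != 0 by rewrite -modulus_gt0; apply: lt_le_trans den.
rewrite !fg//; last exact/in_diskE.
have -> : disk_aut (- lambda) (0 * g 0) = lambda.
  by rewrite mul0r /disk_aut mulr0 subr0 divr1 add0r opprK.
rewrite disk_autN_sub//.
(* Both terms of the bracket are of order [h], with constants [K] and [1], and the denominator is at
   least [1 - |lambda|]; hence the constant given to [derive1_at0]. *)
have -> : (1 - lambda * lambda^*) * (h * g h) / (1 + lambda^* * (h * g h)) -
    (1 - lambda * lambda^*) * g 0 * h =
  (1 - lambda * lambda^*) * h * ((g h - g 0) - g 0 * lambda^* * (h * g h))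
    / (1 + lambda^* * (h * g h)).
  by field.
rewrite !modulusM modulusV ler_pdivrMr; last by apply: lt_le_trans den.
have l2 : modulus (1 - lambda * lambda^*) <= 1.
  rewrite -modulus_sqr -[X in X - _](rmorph1 (real_complex R)) -rmorphB modulusR.
    by rewrite gerBl sqr_ge0.
  by rewrite subr_ge0 expr_le1// ltW.
have num : modulus (g h - g 0 - g 0 * lambda^* * (h * g h)) <= (K + 1) * modulus h.
  have := ler_modulusD (g h - g 0) (- (g 0 * lambda^* * (h * g h))).
  have := gK h; rewrite subr0 => /(_ hr); rewrite modulusN !modulusM modulusJ.
  have : modulus (g 0) * modulus lambda * (modulus h * modulus (g h)) <= modulus h.
    rewrite -(modulusM h); apply: le_trans hgh'; rewrite ler_piMl ?modulus_ge0//.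
    by rewrite mulr_ile1 ?modulus_ge0// ltW.
  lra.
have K1 : 0 <= (K + 1) * modulus h ^+ 2 by rewrite mulr_ge0 ?sqr_ge0//; lra.
apply: (@le_trans _ _ ((K + 1) * modulus h ^+ 2)).
  have A : modulus (1 - lambda * lambda^*) * modulus h <= modulus h by rewrite ler_piMl.
  have := ler_pM (mulr_ge0 (modulus_ge0 _) h0) (modulus_ge0 _) A num; lra.
set D := modulus (1 + _) in den *.
have -> : (K + 1) / (1 - modulus lambda) * modulus h ^+ 2 * D =
  (K + 1) * modulus h ^+ 2 * (D / (1 - modulus lambda)) by ring.
by rewrite ler_peMr// ler_pdivlMr// mul1r.
Qed.

Lemma schur_Hinfty1 lambda h : unit_disk R lambda -> schur h ->
  schur (fun z => disk_aut (- lambda) (z * (z * h z))) /\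
  Hinfty1 (fun z => disk_aut (- lambda) (z * (z * h z))).
Proof.
move=> lD hS; have zhS : schur (fun z => z * h z) by exact: schurM (@schur_id R) hS.
have S : schur (fun z => disk_aut (- lambda) (z * (z * h z))).
  apply: schur_disk_aut; last exact: schurM (@schur_id R) zhS.
  by apply/in_diskE; rewrite modulusN; apply/in_diskE.
split=> //; split; first by have [] := (schurE _).1 S.
by rewrite (derive1_disk_aut lD zhS)// mul0r mulr0.
Qed.

(** The first quotient satisfies [(1 - |lambda|^2) * g 0 = f'(0) = 0], so it vanishes at [0] and can
    be divided once more. *)
Lemma Hinfty1_schur f lambda : schur f -> derive1 (f : C^o -> C^o) 0 = 0 ->
  f 0 = lambda -> unit_disk R lambda ->
  exists2 h, schur h & forall z, unit_disk R z -> disk_aut lambda (f z) = z ^+ 2 * h z.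
Proof.
move=> fS f'0 f0 lD; have /in_diskE l1 := lD.
have [|g gS fg] := schwarz (schur_disk_aut lD fS) zero_disk.
  by rewrite f0 disk_aut_self.
have fE z : unit_disk R z -> f z = disk_aut (- lambda) (z * g z).
  by move=> zD; rewrite -[z in z * _]disk_aut0 -fg// disk_autK//; apply: fS.2.
have g0 : g 0 = 0.
  have /eqP := derive1_disk_aut lD gS fE; rewrite f'0 eq_sym mulf_eq0.
  by rewrite mulrC (negbTE (disk_den_neq0W l1 (ltW l1))) => /eqP.
have [h hS gh] := schwarz gS zero_disk g0.
exists h => // z zD; rewrite fg// gh// !disk_aut0; ring.
Qed.

Lemma psdmx_sumE n (A : 'M[C]_n) (v : 'cV[C]_n) :
  (map_mx Num.conj v^T *m A *m v) 0 0 =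
  \sum_(i < n) \sum_(j < n) (v i 0)^* * v j 0 * A i j.
Proof.
rewrite mxE exchange_big /=; apply: eq_bigr => j _.
rewrite mxE mulr_suml; apply: eq_bigr => i _; rewrite !mxE; ring.
Qed.

End Constrained.

Unset Implicit Arguments.
Set Strict Implicit.

Theorem theorem1p2 (R : realType) (n : nat) (z w : 'I_n -> R[i])
    (z_inj : injective z)
    (z_disk : forall i : 'I_n, unit_disk R (z i))
    (w_disk : forall i : 'I_n, unit_disk R (w i)) :
  (exists f : R[i] -> R[i],
     [/\ Hinfty1 f, Hinfty_norm f <= 1 & forall i : 'I_n, f (z i) = w i])
  <->
  (exists lambda : R[i],
     unit_disk R lambda /\
     psdmx (\matrix_(i < n, j < n)
       ((z i ^+ 2 * (z j ^+ 2)^*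
           - disk_aut lambda (w i) * (disk_aut lambda (w j))^*)
        / (1 - z i * (z j)^*)))).
Proof.
have zero_disk : unit_disk R 0 by apply/in_diskE; rewrite modulus0.
have w1 i : modulus (w i) <= 1 by apply/ltW/in_diskE.
split=> [[f [[fH f'0] fN fw]]|[lambda [lD psd]]].
  have fS : schur f by apply/schurE.
  (* Without nodes any [lambda] will do; otherwise the first node serves to show that [f 0] lies in
     the open disk. *)
  case: n z w z_inj z_disk w_disk w1 fw => [|n] z w z_inj z_disk w_disk w1 fw.
    exists 0; split=> // v; rewrite psdmx_sumE big_ord0; exact: lexx.
  have f0D : unit_disk R (f 0).
    (* If [|f 0| = 1], then [f] is constant by [strong_max] and its value at the first node has
       modulus [1], against [w_disk]. *)
    apply/in_diskE; rewrite lt_neqAle fS.2// andbT; apply/eqP => f01.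
    have := strong_max fS.1 zero_disk _ (z_disk ord0).
    have /in_diskE := w_disk ord0; rewrite -fw => + H.
    rewrite H ?f01 ?ltxx// => y yD; rewrite ?f01; exact: fS.2.
  exists (f 0); split=> // v.
  have [h hS fh] := Hinfty1_schur fS f'0 (erefl _) f0D.
  have := @pick_necessity R _ z z_disk (index_enum 'I_n.+1) h hS (fun i => (v i 0)^* * z i ^+ 2).
  congr (0 <= _); rewrite psdmx_sumE /pick_form; apply: eq_bigr => i _.
  apply: eq_bigr => j _; rewrite mxE -!fw !fh//.
  by rewrite !rmorphM /= conjCK; ring.
have /in_diskE l1 := lD.
have wl i : z i = 0 -> disk_aut lambda (w i) = 0.
  (* Tested on a basis vector, the matrix yields its diagonal entry, here
     [- |phi_lambda (w i)|^2]. *)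
  move=> zi0; have := psd (\col_j (j == i)%:R); rewrite psdmx_sumE.
  rewrite (bigD1 i)//= [X in _ + X]big1 ?addr0 => [|j ji]; last first.
    by rewrite big1// => k _; rewrite !mxE (negbTE ji) rmorph0 !mul0r.
  rewrite (bigD1 i)//= [X in _ + X]big1 ?addr0 => [|j ji]; last first.
    by rewrite !mxE (negbTE ji) mulr0 mul0r.
  rewrite !mxE eqxx rmorph1 zi0 !mul1r expr0n !mul0r subr0 divr1 sub0r -modulus_sqr.
  rewrite oppr_ge0 -[X in _ <= X](rmorph0 (real_complex R)) lecR => m0.
  by apply/eqP; rewrite -modulus_eq0 -sqrf_eq0 eq_le m0 sqr_ge0.
pose s := [seq i <- index_enum 'I_n | z i != 0].
pose g i := disk_aut lambda (w i) / z i ^+ 2.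
have us : uniq s by rewrite filter_uniq ?index_enum_uniq.
have [|h hS hg] := @pick_sufficiency R _ z z_disk s g z_inj us.
  (* The congruence by the [z i ^+ 2], with zero entries at the discarded node; the conjugation is
     there because [psdmx] conjugates the left vector and [pick_form] the right one. *)
  move=> c; have := psd (\col_i (if z i == 0 then 0 else (c i / z i ^+ 2)^*)).
  congr (0 <= _); rewrite psdmx_sumE /pick_form [in RHS]big_filter.
  rewrite [in RHS]big_mkcond; apply: eq_bigr => i _; rewrite !mxE.
  case: eqVneq => [_|zi] /=; first by rewrite big1// => j _; rewrite !mxE rmorph0 !mul0r.
  rewrite [in RHS]big_filter [in RHS]big_mkcond; apply: eq_bigr => j _; rewrite !mxE.
  case: eqVneq => [_|zj] /=; first by rewrite mulr0 mul0r.
  rewrite /g conjCK; move: (disk_aut lambda (w i)) (disk_aut lambda (w j)) => p q.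
  move: (1 - _)^-1 => k; rewrite !(rmorphM, fmorphV, rmorphXn) /=.
  by field; rewrite conjC_eq0 zi zj.
exists (fun y => disk_aut (- lambda) (y * (y * h y))).
have [S H1] := schur_Hinfty1 lD hS.
split=> //; first by have [] := (schurE _).1 S.
move=> i; have -> : z i * (z i * h (z i)) = disk_aut lambda (w i).
  have [zi0|zi0] := eqVneq (z i) 0; first by rewrite wl// zi0 mul0r.
  by rewrite hg ?mem_filter ?zi0 ?mem_index_enum// /g; field.
exact: disk_autK l1 (w1 i).
Qed.
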